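(* Let $T=(V,E)$ be a tree with $n$ vertices, $w:V\to\mathbb{R}^+$ a weight function, $b:V\to\mathbb{Z}^+$ a budget function, and $B$ a positive integer. Then a maximum weight $B$-budgeted independent set of $T$ (an optimal solution of MWBIS on this instance) can be computed in $O(n^2B^3)$ time.
   Context: For a subset $S\subseteq V$, its weight is $\sum_{v\in S}w(v)$ and its budget is $\sum_{v\in S}b(v)$. A $k$-budgeted independent set is an independent set (no two vertices adjacent) whose budget is at most $k$. The Maximum Weight Budgeted Independent Set problem (MWBIS): given $G=(V,E)$, $w$, $b$ and a positive integer $B$, find a $B$-budgeted independent set of maximum weight among all $B$-budgeted independent sets of $G$. *)

(* Defs.v *)
From HB Require Import structures.
From mathcomp Require Import all_boot all_order all_algebra.
From mathcomp Require Import reals.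

Set Implicit Arguments.
Unset Strict Implicit.
Unset Printing Implicit Defensive.

Import Order.TTheory GRing.Theory Num.Theory.

Section Graphs.
Variables (V : finType) (e : rel V).

Definition acyclic : Prop :=
  forall c : seq V, 2 < size c -> uniq c -> ~~ cycle e c.

Definition is_tree : Prop :=
  [/\ 0 < #|V|, symmetric e, irreflexive e,
      (forall x y : V, connect e x y) & acyclic].

Definition independent (S : {set V}) : Prop :=
  {in S &, forall u v, ~~ e u v}.

Variables (R : realType) (w : V -> R) (b : V -> nat).

Definition weight (S : {set V}) : R := (\sum_(v in S) w v)%R.

Definition budget (S : {set V}) : nat := \sum_(v in S) b v.

Definition budgeted_independent (k : nat) (S : {set V}) : Prop :=
  independent S /\ budget S <= k.

Definition is_MWBIS (B : nat) (S : {set V}) : Prop :=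
  budgeted_independent B S /\
  forall S' : {set V}, budgeted_independent B S' -> (weight S' <= weight S)%R.

End Graphs.

(* The model of computation: structured programs for a unit-cost random-access
   machine with an integer memory and a real memory. Each memory consists of
   unbounded arrays named by natural numbers; array names occur only as literals
   in programs (a program uses finitely many arrays), array indices are computed.
   The only arithmetic is addition and subtraction (truncated on nat): without
   unit-cost multiplication, division or rounding, large numbers cannot be used
   to pack an exponential amount of work into one step, and the bounds carry over
   to any richer instruction set. Programs contain no real constant but 0. *)

Inductive iexp : Type :=
| IConst of nat
| IGet of nat & iexp
| IAdd of iexp & iexp
| ISub of iexp & iexp.

Inductive rexp : Type :=
| RZero
| RGet of nat & iexp
| RAdd of rexp & rexp
| RSub of rexp & rexp.

Inductive bexp : Type :=
| BILe of iexp & iexp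
| BRLe of rexp & rexp
| BNot of bexp
| BAnd of bexp & bexp.

Inductive cmd : Type :=
| Skip
| ISet of nat & iexp & iexp
| RSet of nat & iexp & rexp
| Seq of cmd & cmd
| If of bexp & cmd & cmd
| While of bexp & cmd.

Record state (R : Type) : Type :=
  State { imem : nat -> nat -> nat; rmem : nat -> nat -> R }.

Definition upd (A : Type) (m : nat -> nat -> A) (a i : nat) (x : A) :
    nat -> nat -> A :=
  fun a' i' => if (a' == a) && (i' == i) then x else m a' i'.

Section Semantics.
Variable R : realType.
Implicit Type s : state R.

Fixpoint ieval s (x : iexp) : nat :=
  match x with
  | IConst k => k
  | IGet a i => imem s a (ieval s i)
  | IAdd x1 x2 => ieval s x1 + ieval s x2
  | ISub x1 x2 => ieval s x1 - ieval s x2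
  end.

Fixpoint reval s (x : rexp) : R :=
  match x with
  | RZero => 0%R
  | RGet a i => rmem s a (ieval s i)
  | RAdd x1 x2 => (reval s x1 + reval s x2)%R
  | RSub x1 x2 => (reval s x1 - reval s x2)%R
  end.

Fixpoint beval s (x : bexp) : bool :=
  match x with
  | BILe x1 x2 => ieval s x1 <= ieval s x2
  | BRLe x1 x2 => (reval s x1 <= reval s x2)%R
  | BNot x1 => ~~ beval s x1
  | BAnd x1 x2 => beval s x1 && beval s x2
  end.

(* One time unit per node of an evaluated expression. *)
Fixpoint icost (x : iexp) : nat :=
  match x with
  | IConst _ => 1
  | IGet _ i => (icost i).+1
  | IAdd x1 x2 | ISub x1 x2 => (icost x1 + icost x2).+1
  end.

Fixpoint rcost (x : rexp) : nat :=
  match x with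
  | RZero => 1
  | RGet _ i => (icost i).+1
  | RAdd x1 x2 | RSub x1 x2 => (rcost x1 + rcost x2).+1
  end.

Fixpoint bcost (x : bexp) : nat :=
  match x with
  | BILe x1 x2 => (icost x1 + icost x2).+1
  | BRLe x1 x2 => (rcost x1 + rcost x2).+1
  | BNot x1 => (bcost x1).+1
  | BAnd x1 x2 => (bcost x1 + bcost x2).+1
  end.

(* [exec p s t s']: started in s, the program p halts in s' after t time
   units. *)
Inductive exec : cmd -> state R -> nat -> state R -> Prop :=
| ExecSkip s : exec Skip s 1 s
| ExecISet s a i x :
    exec (ISet a i x) s (icost i + icost x).+1
      (State (upd (imem s) a (ieval s i) (ieval s x)) (rmem s))
| ExecRSet s a i x :
    exec (RSet a i x) s (icost i + rcost x).+1
      (State (imem s) (upd (rmem s) a (ieval s i) (reval s x)))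
| ExecSeq p1 p2 s s1 s2 t1 t2 :
    exec p1 s t1 s1 -> exec p2 s1 t2 s2 -> exec (Seq p1 p2) s (t1 + t2) s2
| ExecIfTrue x p1 p2 s s1 t :
    beval s x -> exec p1 s t s1 -> exec (If x p1 p2) s (bcost x + t).+1 s1
| ExecIfFalse x p1 p2 s s1 t :
    ~~ beval s x -> exec p2 s t s1 -> exec (If x p1 p2) s (bcost x + t).+1 s1
| ExecWhileTrue x p s s1 s2 t1 t2 :
    beval s x -> exec p s t1 s1 -> exec (While x p) s1 t2 s2 ->
    exec (While x p) s (bcost x + t1 + t2).+1 s2
| ExecWhileFalse x p s :
    ~~ beval s x -> exec (While x p) s (bcost x).+1 s.

Lemma exec_det p s t1 s1 t2 s2 :
  exec p s t1 s1 -> exec p s t2 s2 -> t1 = t2 /\ s1 = s2.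
Proof.
move=> E; elim: E t2 s2 => {p s t1 s1}.
- by move=> s t2 s2 E; inversion E.
- by move=> s a i x t2 s2 E; inversion E.
- by move=> s a i x t2 s2 E; inversion E.
- move=> p1 p2 s s1 s2 t1 t2 _ IH1 _ IH2 t s' E.
  inversion E as [| | |? ? ? u1 ? ? ? E1 E2| | | |]; subst.
  have [? ?] := IH1 _ _ E1; subst.
  by have [-> ->] := IH2 _ _ E2.
- move=> x p1 p2 s s1 t bx _ IH t2 s2 E.
  inversion E as [| | | |? ? ? ? ? ? bx' E1|? ? ? ? ? ? bx' E1| |]; subst.
    by have [-> ->] := IH _ _ E1.
  by rewrite bx in bx'.
- move=> x p1 p2 s s1 t bx _ IH t2 s2 E.
  inversion E as [| | | |? ? ? ? ? ? bx' E1|? ? ? ? ? ? bx' E1| |]; subst.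
    by rewrite bx' in bx.
  by have [-> ->] := IH _ _ E1.
- move=> x p s s1 s2 t1 t2 bx _ IH1 _ IH2 t s' E.
  inversion E as [| | | | | |? ? ? ? ? ? ? bx' E1 E2|? ? ? bx']; subst.
    have [? ?] := IH1 _ _ E1; subst.
    by have [-> ->] := IH2 _ _ E2.
  by rewrite bx in bx'.
- move=> x p s bx t s' E.
  inversion E as [| | | | | |? ? ? ? ? ? ? bx' E1 E2|]; subst => //.
  by rewrite bx' in bx.
Qed.

End Semantics.

Section InputOutput.
Variables (R : realType) (n : nat) (e : rel 'I_n).
Variables (w : 'I_n -> R) (b : 'I_n -> nat) (B : nat).

(* Values of the adjacency matrix in row-major order: the entry (i, j) is at
   position i * n + j. *)
Definition adjacency (k : nat) : nat :=
  match insub (k %/ n), insub (k %% n) with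
  | Some i, Some j => e i j
  | _, _ => 0
  end.

(* Integer array 0 holds n, array 1 holds B (both at index 0), array 2 the
   adjacency matrix, array 3 the budgets; real array 0 holds the weights. All
   other cells are 0. *)
Definition input_imem (a k : nat) : nat :=
  match a with
  | 0 => if k == 0 then n else 0
  | 1 => if k == 0 then B else 0
  | 2 => adjacency k
  | 3 => oapp b 0 (insub k)
  | _ => 0
  end.

Definition input_rmem (a k : nat) : R :=
  match a with
  | 0 => oapp w 0%R (insub k)
  | _ => 0%R
  end.

Definition input : state R := State input_imem input_rmem.

(* The result is read off integer array 4, as a characteristic vector. *)
Definition output (s : state R) : {set 'I_n} := [set v : 'I_n | imem s 4 v == 1].

End InputOutput.

Arguments output {R} n s.

(* Main.v *)
Require Import Defs.
From HB Require Import structures.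
From mathcomp Require Import all_boot all_order all_algebra.
From mathcomp Require Import reals.
From mathcomp Require Import zify.

(* Search the tree from vertex 0; acyclicity makes the parent of a vertex its only
   neighbour among the vertices discovered earlier. Contract the vertices into
   their parents in reverse order of discovery. For every vertex v still present,
   whose class D consists of the vertices contracted into v, and every budget
   k <= B, keep an optimal independent subset of D of budget at most k, both among
   all subsets (flag true) and among those avoiding v (flag false). When v is
   contracted into u, the single edge between the classes is (u, v), so an
   independent set of the union avoids u on one side or v on the other:
     T'(u, false, k) = max_j T(u, false, j) + T(v, true, k - j),
     T'(u, true, k) = max (T'(u, false, k), max_j T(u, true, j) + T(v, false,
       k - j)).
   Since no flag requires a vertex to be taken, the empty set is always feasible.
   Since budgets are positive, the term j = k is the old entry of u, and the tables
   can be updated in place. The sets are stored as characteristic vectors and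
   copied at each improvement, which costs O(n^2 B^2) in total. *)

Set Implicit Arguments.
Unset Strict Implicit.
Unset Printing Implicit Defensive.

Import Order.TTheory GRing.Theory Num.Theory.

(** * A time-bounded program logic *)

(** A syntactic bound on the integer arrays a program may write; since array names are literals,
    frame conditions are then decided by computation. *)
Fixpoint iwrites (p : cmd) : seq nat :=
  match p with
  | ISet a _ _ => [:: a]
  | Seq p1 p2 | If _ p1 p2 => iwrites p1 ++ iwrites p2
  | While _ p1 => iwrites p1
  | _ => [::]
  end.

Fixpoint rwrites (p : cmd) : seq nat :=
  match p with
  | RSet a _ _ => [:: a]
  | Seq p1 p2 | If _ p1 p2 => rwrites p1 ++ rwrites p2
  | While _ p1 => rwrites p1
  | _ => [::]
  end.

Fixpoint flat (p : cmd) : bool :=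
  match p with
  | Seq p1 p2 | If _ p1 p2 => flat p1 && flat p2
  | While _ _ => false
  | _ => true
  end.

(** Worst-case cost of a loop-free program. The value at [While] is a dummy: only [flat] programs
    are measured. *)
Fixpoint flat_cost (p : cmd) : nat :=
  match p with
  | Skip => 1
  | ISet _ i x => (icost i + icost x).+1
  | RSet _ i x => (icost i + rcost x).+1
  | Seq p1 p2 => flat_cost p1 + flat_cost p2
  | If x p1 p2 => (bcost x + maxn (flat_cost p1) (flat_cost p2)).+1
  | While _ _ => 0
  end.

Definition var (a : nat) : iexp := IGet a (IConst 0).

Definition for_loop (x : nat) (bound : iexp) (body : cmd) : cmd :=
  Seq (ISet x (IConst 0) (IConst 0))
      (While (BNot (BILe bound (var x)))
             (Seq body (ISet x (IConst 0) (IAdd (var x) (IConst 1))))).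

(** A round costs [t] for the body, [icost bound + 5] for the test and 6 for the increment; the
    initial assignment costs 3 and the failing last test [icost bound + 5]. *)
Definition for_cost (bound : iexp) (N t : nat) : nat :=
  N * (t + icost bound + 11) + icost bound + 8.

Section Logic.
Variable R : realType.
Implicit Types (s : state R) (p : cmd) (Q : state R -> Prop).

Definition iset s a i x : state R := State (upd (imem s) a i x) (rmem s).
Definition rset s a i x : state R := State (imem s) (upd (rmem s) a i x).

(** Total correctness: halting is part of the claim. The time [t] is only an upper bound, so that
    branches of different cost can share it. *)
Definition runs p s t Q : Prop :=
  exists t' s', [/\ exec p s t' s', t' <= t & Q s'].

Definition same_off (I J : seq nat) s s' : Prop :=
  (forall a, a \notin I -> imem s' a =1 imem s a) /\
  (forall a, a \notin J -> rmem s' a =1 rmem s a).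

Lemma same_off_refl I J s : same_off I J s s.
Proof. by split. Qed.

Lemma same_off_trans I J s1 s2 s3 :
  same_off I J s1 s2 -> same_off I J s2 s3 -> same_off I J s1 s3.
Proof.
move=> [i1 r1] [i2 r2].
by split=> a Ha k; [rewrite i2 // i1|rewrite r2 // r1].
Qed.

Lemma same_offS I J I' J' s s' :
  {subset I <= I'} -> {subset J <= J'} -> same_off I J s s' -> same_off I' J' s s'.
Proof.
move=> sI sJ [i r]; split=> a Ha.
  by apply: i; apply: contra Ha => /sI.
by apply: r; apply: contra Ha => /sJ.
Qed.

Lemma same_off_all I J I' J' s s' :
  all (mem I') I -> all (mem J') J -> same_off I J s s' -> same_off I' J' s s'.
Proof. by move=> /allP sI /allP sJ; apply: same_offS. Qed.

Lemma iset_off s a i x : same_off [:: a] [::] s (iset s a i x).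
Proof. by split=> // y; rewrite inE => /negPf ya j; rewrite /= /upd ya. Qed.

Lemma rset_off s a i x : same_off [::] [:: a] s (rset s a i x).
Proof. by split=> // y; rewrite inE => /negPf ya j; rewrite /= /upd ya. Qed.

Lemma exec_same_off p s t s' : exec p s t s' -> same_off (iwrites p)
  (rwrites p) s s'.
Proof.
elim=> {p s t s'} /=.
- by move=> s; apply: same_off_refl.
- by move=> s a i x; apply: iset_off.
- by move=> s a i x; apply: rset_off.
- move=> p1 p2 s s1 s2 t1 t2 _ IH1 _ IH2.
  by apply: (@same_off_trans _ _ _ s1); [apply: same_offS IH1|apply: same_offS IH2];
     move=> a; rewrite mem_cat => ->; rewrite ?orbT.
- by move=> x p1 p2 s s1 t _ _; apply: same_offS => a; rewrite mem_cat => ->.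
- by move=> x p1 p2 s s1 t _ _; apply: same_offS => a; rewrite mem_cat => ->;
    rewrite orbT.
- by move=> x p s s1 s2 t1 t2 _ _ H1 _; apply: same_off_trans H1.
- by move=> x p s _; apply: same_off_refl.
Qed.

Lemma runs_weaken p s t t' Q Q' :
  runs p s t Q -> t <= t' -> (forall s', Q s' -> Q' s') -> runs p s t' Q'.
Proof.
move=> [t1 [s1 [E H HQ]]] le QQ; exists t1, s1; split=> //.
- exact: leq_trans le.
- exact: QQ.
Qed.

Lemma runs_frame p s t Q :
  runs p s t Q -> runs p s t (fun s' => Q s' /\ same_off (iwrites p)
    (rwrites p) s s').
Proof.
move=> [t1 [s1 [E H HQ]]]; exists t1, s1; split=> //; split=> //.
exact: exec_same_off E.
Qed.

Lemma runs_seq p1 p2 s t1 t2 Q :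
  runs p1 s t1 (fun s1 => runs p2 s1 t2 Q) -> runs (Seq p1 p2) s (t1 + t2) Q.
Proof.
move=> [u1 [s1 [E1 H1 [u2 [s2 [E2 H2 HQ]]]]]].
by exists (u1 + u2), s2; split=> //; [apply: ExecSeq E1 E2|apply: leq_add].
Qed.

Lemma runs_if x p1 p2 s t Q :
  (beval s x -> runs p1 s t Q) -> (~~ beval s x -> runs p2 s t Q) ->
  runs (If x p1 p2) s (bcost x + t).+1 Q.
Proof.
move=> H1 H2; case: (boolP (beval s x)) => bx.
  have [u [s1 [E H HQ]]] := H1 bx.
  by exists (bcost x + u).+1, s1; split=> //; [apply: ExecIfTrue|
    rewrite ltnS leq_add2l].
have [u [s1 [E H HQ]]] := H2 bx.
by exists (bcost x + u).+1, s1; split=> //; [apply: ExecIfFalse|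
  rewrite ltnS leq_add2l].
Qed.

Fixpoint step p s : state R :=
  match p with
  | ISet a i x => iset s a (ieval s i) (ieval s x)
  | RSet a i x => rset s a (ieval s i) (reval s x)
  | Seq p1 p2 => step p2 (step p1 s)
  | If x p1 p2 => if beval s x then step p1 s else step p2 s
  | _ => s
  end.

Lemma runs_flat p s Q : flat p -> Q (step p s) -> runs p s (flat_cost p) Q.
Proof.
elim: p s Q => //=.
- by move=> s Q _ HQ; exists 1, s; split=> //; apply: ExecSkip.
- by move=> a i x s Q _ HQ; eexists; eexists; split; [apply: ExecISet| |].
- by move=> a i x s Q _ HQ; eexists; eexists; split; [apply: ExecRSet| |].
- move=> p1 IH1 p2 IH2 s Q /andP[f1 f2] HQ.
  by apply: runs_seq; apply: IH1 => //; apply: IH2.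
- move=> x p1 IH1 p2 IH2 s Q /andP[f1 f2] HQ.
  apply: runs_if => bx; rewrite ?bx ?(negPf bx) in HQ.
    by apply: runs_weaken (IH1 _ _ f1 HQ) _ _; rewrite ?leq_maxl.
  by apply: runs_weaken (IH2 _ _ f2 HQ) _ _; rewrite ?leq_maxr.
Qed.

(** The bound is evaluated anew at each test, hence the premise that it keeps the value [N]. The
    body may assume that all arrays outside the write set are as on entry to the loop, so [P] need
    only describe what changes. *)
Lemma runs_for x bound body N t (P : nat -> state R -> Prop) s :
    x \notin iwrites body ->
    (forall s', same_off (x :: iwrites body) (rwrites body) s s'
      -> ieval s' bound = N) ->
    P 0 (iset s x 0 0) ->
    (forall i s', i < N -> imem s' x 0 = i ->
       same_off (x :: iwrites body) (rwrites body) s s' -> P i s' ->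
       runs body s' t (fun s1 => P i.+1 (iset s1 x 0 i.+1))) ->
  runs (for_loop x bound body) s (for_cost bound N t) (P N).
Proof.
move=> xW bN P0 PS.
have W s0 k : same_off (x :: iwrites body) (rwrites body) s0 (iset s0 x 0 k).
  by apply: same_off_all (iset_off _ _ _ _); rewrite //= mem_head.
(* Induction on the number [m] of rounds still to run. *)
suff L m i s1 : i + m = N -> imem s1 x 0 = i ->
    same_off (x :: iwrites body) (rwrites body) s s1 -> P i s1 ->
    runs (While (BNot (BILe bound (var x)))
             (Seq body (ISet x (IConst 0) (IAdd (var x) (IConst 1)))))
      s1 (m * (t + icost bound + 11) + icost bound + 5) (P N).
  apply: (@runs_weaken _ _ (3 + (N * (t + icost bound + 11) + icost bound + 5))
    _ (P N) (P N)); last by [].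
  - apply: runs_seq; exists 3, (iset s x 0 0); split=> //; first exact: ExecISet.
    by apply: (L N 0) => //=; rewrite /upd !eqxx.
  - rewrite /for_cost; lia.
elim: m i s1 => [|m IH] i s1 iN xi S1 Pi.
  exists (bcost (BNot (BILe bound (var x)))).+1, s1; split.
  - by apply: ExecWhileFalse; rewrite /= bN // xi negbK; lia.
  - rewrite /=; lia.
  - by have -> : N = i by lia.
have [|u [s2 [E2 u_le P2]]] := PS i s1 _ xi S1 Pi; first lia.
have S2 := exec_same_off E2.
have x2 : imem s2 x 0 = i by rewrite S2.1.
have S12 : same_off (x :: iwrites body) (rwrites body) s s2.
  apply: same_off_trans S1 _; apply: same_offS S2 => // a.
  by rewrite inE => ->; rewrite orbT.
have [||||u3 [s3 [E3 u3_le P3]]] := IH i.+1 (iset s2 x 0 i.+1).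
- lia.
- by rewrite /= /upd !eqxx.
- exact: same_off_trans S12 (W _ _).
- exact: P2.
exists (bcost (BNot (BILe bound (var x))) + (u + 6) + u3).+1, s3; split=> //.
- apply: ExecWhileTrue; first by rewrite /= bN // xi; lia.
    apply: (ExecSeq E2); exact: ExecISet.
  by move: E3; rewrite /iset /= x2 addn1.
- rewrite /=; lia.
Qed.

End Logic.

(** * Search trees and optimal sets *)

Section SearchOrder.
Variables (V : finType) (e : rel V) (x0 : V).
Hypotheses (e_sym : symmetric e) (e_acyclic : acyclic e).

(** [q] is the order of discovery and [p] lists the parents at the same positions. Entry 0 of [p] is
    unconstrained, as the root has no parent. *)
Definition search_tree (q p : seq V) : Prop :=
  uniq q /\ forall j, 0 < j < size q ->
    (nth x0 p j \in take j q) && e (nth x0 q j) (nth x0 p j).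

Definition inside (A : seq V) : rel V :=
  [rel x y | [&& x \in A, y \in A & e x y]].

(** Otherwise a simple path from [x] to [y] within [A], closed up through [z], would be a cycle of
    length at least 3. *)
Lemma inside_connected_unique_edge (A : seq V) z x y :
  z \notin A -> x \in A -> y \in A -> connect (inside A) x y ->
  e z x -> e z y -> y = x.
Proof.
move=> zA xA yA /connectP[c0 pc0 ey] ezx ezy.
move: ey; case/shortenP: pc0 => c pc uc _ ey.
have [->//|xy] := eqVneq y x.
case: c pc uc ey => [_ _ ey|c1 c pc uc ey]; first by rewrite ey eqxx in xy.
have cA : all (mem A) (x :: c1 :: c).
  apply/allP => a; rewrite inE => /orP[/eqP->//|]; move: (pc).
  elim: (c1 :: c) (x) => //= d l IH b /andP[/and3P[_ dA _] pl].
  by rewrite inE => /orP[/eqP->//|]; apply: IH pl.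
have zc : z \notin x :: c1 :: c.
  by apply: contra zA => zin; exact: (allP cA).
have /negP[] := @e_acyclic (z :: x :: c1 :: c) isT (introT andP (conj zc uc)).
have pe : path e x (c1 :: c).
  by apply: sub_path pc => a b /and3P[].
rewrite /= ezx /=; move: pe => /= /andP[-> pe] /=.
by rewrite rcons_path pe /= e_sym; move: ey => /= <-.
Qed.

(** Each newly discovered vertex is joined to its parent, which lies in the prefix already known to
    be connected. *)
Lemma search_tree_connected (q p : seq V) j x y :
  search_tree q p -> j <= size q -> x \in take j q -> y \in take j q ->
  connect (inside (take j q)) x y.
Proof.
move=> [uq pq]; have ins_sym A : connect_sym (inside A).
  by apply: sym_connect_sym => a b; rewrite /inside /= e_sym andbCA.
elim: j x y => [|j IH] x y jq; first by rewrite take0.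
have T : take j.+1 q = rcons (take j q) (nth x0 q j) by rewrite (take_nth x0).
have sub a b : a \in take j q -> b \in take j q ->
    connect (inside (take j.+1 q)) a b.
  move=> aq bq; apply: connect_sub (IH a b (ltnW jq) aq bq)
    => c d /and3P[cq dq ecd].
  by apply: connect1; rewrite /inside /= T !mem_rcons !inE cq dq ecd !orbT.
have last_par : 0 < j -> connect (inside (take j.+1 q)) (nth x0 q j) (nth x0 p j)
      /\ nth x0 p j \in take j q.
  move=> j0; have /andP[pin ee] := pq j (introT andP (conj j0 jq)).
  split=> //; apply: connect1.
  by rewrite /inside /= T !mem_rcons !inE eqxx pin ee orbT.
have last_conn a : a \in take j q -> connect (inside (take j.+1 q)) (nth x0 q j) a.
  case: (posnP j) => [->|j0 aq]; first by rewrite take0.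
  have [c1 pin] := last_par j0.
  by apply: connect_trans c1 (sub _ _ pin aq).
rewrite {1 2}T !mem_rcons !inE => /orP[/eqP->|xq] /orP[/eqP->|yq].
- exact: connect0.
- exact: last_conn.
- by rewrite ins_sym; exact: last_conn.
- exact: sub.
Qed.

(** The earlier vertices are connected among themselves, so a second edge into them would close a
    cycle. *)
Lemma search_tree_parent_unique (q p : seq V) j y :
  search_tree q p -> 0 < j < size q -> y \in take j q ->
  e (nth x0 q j) y -> y = nth x0 p j.
Proof.
move=> S jq yq ey; have [uq /(_ j jq)/andP[pin ep]] := S; have [_ jq'] := andP jq.
apply: (@inside_connected_unique_edge (take j q) (nth x0 q j)) => //.
  have := take_uniq j.+1 uq.
  by rewrite (take_nth x0) // rcons_uniq => /andP[].
by apply: search_tree_connected S (ltnW jq') _ _.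
Qed.

End SearchOrder.

Lemma disjointsUl (T : finType) (A B C : {set T}) :
  [disjoint A & C] -> [disjoint B & C] -> [disjoint A :|: B & C].
Proof. by rewrite -!setI_eq0 setIUl => /eqP-> /eqP->; rewrite setU0. Qed.

(** * Optimal sets for a class, a flag and a budget *)

Section Tables.
Variables (V : finType) (e : rel V) (R : realType) (w : V -> R) (b : V -> nat).
Hypotheses (e_sym : symmetric e) (b_pos : forall v, 0 < b v).
Implicit Types (D S : {set V}) (r : V) (d : bool).

Definition feasible D r d k S : Prop :=
  [/\ S \subset D, independent e S, budget b S <= k & d || (r \notin S)].

Definition best D r d k S : Prop :=
  feasible D r d k S /\
  forall S', feasible D r d k S' -> (weight w S' <= weight w S)%R.

Lemma weightU S1 S2 : [disjoint S1 & S2] ->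
  weight w (S1 :|: S2) = (weight w S1 + weight w S2)%R.
Proof. by move=> dis; rewrite /weight -bigU //; apply: eq_bigl => x;
  rewrite !inE. Qed.

Lemma budgetU S1 S2 : [disjoint S1 & S2] ->
  budget b (S1 :|: S2) = budget b S1 + budget b S2.
Proof. by move=> dis; rewrite /budget -bigU //; apply: eq_bigl => x;
  rewrite !inE. Qed.

Lemma weight1 v : weight w [set v] = w v.
Proof. exact: big_set1. Qed.

Lemma weight0 : weight w set0 = 0%R.
Proof. exact: big_set0. Qed.

Lemma budget_eq0 S : budget b S = 0 -> S = set0.
Proof.
move=> S0; apply/setP => x; rewrite inE; apply/negP => xS.
move: S0; rewrite /budget (bigD1 x) //=; have := b_pos x; lia.
Qed.

Lemma best_singleton v d k : (0 < w v)%R -> irreflexive e ->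
  best [set v] v d k (if d && (b v <= k) then [set v] else set0).
Proof.
move=> wv e_irr; split.
  case: ifP => [/andP[-> bk]|_]; split; rewrite ?sub0set ?orbT ?subxx ?inE ?orbT //.
  - by move=> x y; rewrite !inE => /eqP-> /eqP->; rewrite e_irr.
  - by rewrite /budget big_set1.
  - by move=> x y; rewrite inE.
  - by rewrite /budget big_set0.
move=> S [sub _ bS rS].
have w0 : (0 <= weight w (if d && (b v <= k)%N then [set v] else set0))%R.
  by case: ifP; rewrite ?weight0 // weight1 ltW.
move: sub; rewrite subset1 => /orP[/eqP SE|/eqP->]; last by rewrite weight0.
move: bS rS; rewrite SE /budget big_set1 inE eqxx orbF => -> ->.
by rewrite lexx.
Qed.

Section Merge.
Variables (Du Dv : {set V}) (u v : V).
Hypotheses (Duv : [disjoint Du & Dv]) (vD : v \in Dv) (uD : u \in Du) (euv : e u v).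
Hypothesis cross : forall x y, x \in Du -> y \in Dv -> e x y -> x = u /\ y = v.

(** The only edge between the classes is ([u], [v]), and one of the two flags forbids its
    endpoint. *)
Lemma feasibleU a c d k j S1 S2 : a ==> d -> ~~ (a && c) -> j <= k ->
  feasible Du u a j S1 -> feasible Dv v c (k - j) S2 ->
  feasible (Du :|: Dv) u d k (S1 :|: S2).
Proof.
move=> ad ac jk [s1 i1 b1 u1] [s2 i2 b2 v2].
have cr x y : x \in S1 -> y \in S2 -> ~~ e x y.
  move=> x1 y2; apply/negP => exy.
  have [xu yv] := cross (subsetP s1 _ x1) (subsetP s2 _ y2) exy; subst x y.
  by move: ac u1 v2; rewrite x1 y2 /= !orbF => /negP nac a1 c1; apply: nac;
    rewrite a1 c1.
split.
- exact: setUSS.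
- move=> x y; rewrite !inE => /orP[x1|x2] /orP[y1|y2].
  + exact: i1.
  + exact: cr.
  + by rewrite e_sym; apply: cr.
  + exact: i2.
- rewrite budgetU; first by clear -b1 b2 jk; lia.
  exact: disjointW s1 s2 Duv.
- case: d ad => //=; rewrite implybF => /negPf a0; rewrite a0 /= in u1.
  rewrite inE negb_or u1 /=; apply/negP => /(subsetP s2) uDv.
  by move/disjointFr: Duv => /(_ _ uD); rewrite uDv.
Qed.

(** Any competitor splits along the two classes. Either it has nothing in [Dv], and the old entry of
    [u] dominates it, or its part in [Du] has some budget [j < k], and it is dominated by the sum
    for [j] and for the flag telling whether it contains [u]. *)
Lemma best_merge d k S (t0 : bool -> nat -> {set V}) (t1 : bool -> nat -> {set V}) :
  (forall a j, j <= k -> best Du u a j (t0 a j)) ->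
  (forall c j, j <= k -> best Dv v c j (t1 c j)) ->
  feasible (Du :|: Dv) u d k S ->
  (weight w (t0 d k) <= weight w S)%R ->
  (forall j a, j < k -> a ==> d ->
     (weight w (t0 a j) + weight w (t1 (~~ a) (k - j)%N) <= weight w S)%R) ->
  best (Du :|: Dv) u d k S.
Proof.
move=> B0 B1 F lek lej; split=> // S' [sub ind bud du].
have dis : [disjoint S' :&: Du & S' :&: Dv].
  by apply: disjointW Duv; apply: subsetIr.
have SE : S' = (S' :&: Du) :|: (S' :&: Dv).
  by rewrite -setIUr; apply/esym/setIidPl.
have bE := budgetU dis; rewrite -SE in bE.
have indI D : independent e (S' :&: D).
  by move=> x y /setIP[xS _] /setIP[yS _]; apply: ind.
(* Budgets are positive, so a part of budget 0 is empty; a nonempty part in [Dv] leaves strictly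
   less than [k] for [Du]. *)
case: (posnP (budget b (S' :&: Dv))) => [/budget_eq0 S0|pos].
  apply: le_trans lek; apply: (B0 d k (leqnn k)).2; split=> //.
  by rewrite SE S0 setU0 subsetIr.
set j := budget b (S' :&: Du) in bE.
have jk : j < k by clear -bE bud pos; lia.
rewrite SE weightU //.
(* The flag of [u] is read off [S']. If [u] is taken, the edge from [u] to [v] keeps [v] out, as the
   opposite flag demands. *)
apply: (@le_trans _ _ (weight w (t0 (u \in S') j) + weight w (t1 (u \notin S')
  (k - j)%N))%R).
  apply: lerD.
    apply: (B0 _ _ (ltnW jk)).2; split=> //; first exact: subsetIr.
    by rewrite inE uD andbT orbN.
  apply: (B1 _ _ (leq_subr _ _)).2; split=> //; first exact: subsetIr.
    by clear -bE bud; lia.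
  case: (boolP (u \in S')) => //= uS; rewrite inE vD andbT.
  by apply/negP => vS; move: (ind u v uS vS); rewrite euv.
apply: lej => //; apply/implyP => uS.
by move: du; rewrite uS orbF.
Qed.

End Merge.

(** * Contracting the tree along the search order *)

Section Partition.
Variables (x0 : V) (q p : seq V).

(** The first [m] vertices of [q] represent a partition into classes [D]. The last clause lets an
    edge between two classes join only their representatives, which makes a merge hinge on a single
    edge. *)
Definition contracted (m : nat) (D : V -> {set V}) : Prop :=
  [/\ forall x, exists2 z, z \in take m q & x \in D z,
      {in take m q, forall z, z \in D z},
      {in take m q &, forall z z', z != z' -> [disjoint D z & D z']} &
      {in take m q &, forall z z', z != z' ->
         forall x y, x \in D z -> y \in D z' -> e x y -> x = z /\ y = z'}].

Definition contract (D : V -> {set V}) (u v z : V) : {set V} :=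
  if z == u then D u :|: D v else D z.

Lemma contracted_full : (forall x, x \in q) ->
  contracted (size q) (fun z => [set z]).
Proof.
move=> qT; rewrite /contracted take_size; split.
- by move=> x; exists x; rewrite ?inE.
- by move=> z _; rewrite inE.
- by move=> z z' _ _ zz'; rewrite disjoints1 inE.
- by move=> z z' _ _ _ x y; rewrite !inE => /eqP-> /eqP->.
Qed.

(** Among the representatives that remain, the one discovered last is adjacent only to its parent.
    Its class thus has edges to no other class, and the parent's class can absorb it without gaining
    a crossing edge. *)
Lemma contracted_step m (D : V -> {set V}) : acyclic e -> search_tree e x0 q p ->
  0 < m < size q -> contracted m.+1 D ->
  contracted m (contract D (nth x0 p m) (nth x0 q m)).
Proof.
move=> acy S mq [cov self dis cross].
have [uq /(_ m mq)/andP[pin ep]] := S; have [m0 mq'] := andP mq.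
have uniqpar := search_tree_parent_unique e_sym acy S mq.
set v := nth x0 q m in uniqpar ep *; set u := nth x0 p m in uniqpar pin ep *.
have T : take m.+1 q = rcons (take m q) v by rewrite (take_nth x0).
have vT : v \in take m.+1 q by rewrite T mem_rcons inE eqxx.
have sT z : z \in take m q -> z \in take m.+1 q.
  by move=> zq; rewrite T mem_rcons inE zq orbT.
have vN z : z \in take m q -> (v == z) = false.
  have := take_uniq m.+1 uq; rewrite T rcons_uniq => /andP[vq _] zq.
  by apply/negP => /eqP vz; rewrite vz zq in vq.
have uT := sT _ pin.
(* Such an edge would be the edge from [v] to [z], making [z] the parent of [v]. *)
have crossV z x y : z \in take m q -> z != u -> x \in D v -> y \in D z -> ~~ e x y.
  move=> zq zu xD yD; apply/negP => exy.
  have [xv yz] : x = v /\ y = z by apply: (cross v z) => //; rewrite ?sT // vN.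
  by subst x y; rewrite (uniqpar z zq exy) eqxx in zu.
split.
- move=> x; have [z] := cov x; rewrite T mem_rcons inE => /orP[/eqP->|zq] xD.
    by exists u; rewrite // /contract eqxx inE xD orbT.
  exists z => //; rewrite /contract; case: eqP => [<-|//].
  by rewrite inE xD.
- move=> z zq; rewrite /contract; case: eqP => [<-|_]; last exact: self (sT _ zq).
  by rewrite inE self // sT.
- move=> z z' zq zq' zz'; rewrite /contract; case: eqP => [zu|_];
    case: eqP => [zu'|_].
  + by rewrite zu zu' eqxx in zz'.
  + subst z; rewrite disjointsUl //; first by apply: dis => //; apply: sT.
    by apply: dis => //; rewrite ?sT // vN.
  + subst z'; rewrite disjoint_sym disjointsUl //; rewrite disjoint_sym;
      apply: dis => //; rewrite ?sT //.
    by rewrite eq_sym vN.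
  + by apply: dis => //; apply: sT.
- move=> z z' zq zq' zz' x y; rewrite /contract; case: eqP => [zu|_];
    case: eqP => [zu'|_].
  + by rewrite zu zu' eqxx in zz'.
  + subst z; rewrite inE => /orP[xD|xD] yD exy.
      by apply: (cross u z') => //; apply: sT.
    by move: (crossV z' x y zq'); rewrite eq_sym zz' exy => /(_ isT xD yD).
  + subst z'; rewrite inE => xD /orP[yD|yD] exy.
      by apply: (cross z u) => //; apply: sT.
    by move: (crossV z y x zq); rewrite zz' e_sym exy => /(_ isT yD xD).
  + by apply: cross => //; apply: sT.
Qed.

End Partition.
End Tables.

(** * The program *)

(* Integer arrays: 5 holds the multiples of n and 6 those of B + 1 (there is no
   multiplication), 7 flags the vertices met by the search, 8 and 9 list these
   vertices and their parents in order of discovery. The tables have a cell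
   v * (B + 1) + k for each vertex v and budget k: real array 1 + d holds its
   weight and integer array 10 + d, from position n * cell on, the characteristic
   vector of the set. Integer arrays 12 to 19 are scalar variables. *)
Definition cell (v k : iexp) : iexp := IAdd (IGet 6 v) k.
Definition bit (c x : iexp) : iexp := IAdd (IGet 5 c) x.
Definition weights (d : bool) : nat := 1 + d.
Definition bits (d : bool) : nat := 10 + d.

(** Repeated addition, starting from entry 0, which must already be 0. *)
Definition multiples (a : nat) (bound inc : iexp) : cmd :=
  for_loop 12 bound
    (ISet a (IAdd (var 12) (IConst 1)) (IAdd (IGet a (var 12)) inc)).

(** Array 6 comes first: its entry at [n] is the product of [n] and [B + 1], the length needed for
    array 5. *)
Definition address_tables : cmd :=
  Seq (multiples 6 (var 0) (IAdd (var 1) (IConst 1)))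
      (multiples 5 (IGet 6 (var 0)) (var 0)).

Definition visit : cmd :=
  Seq (ISet 7 (var 18) (IConst 1))
  (Seq (ISet 8 (var 19) (var 18))
  (Seq (ISet 9 (var 19) (IGet 8 (var 12)))
       (ISet 19 (IConst 0) (IAdd (var 19) (IConst 1))))).

(** Cell 12 is the queue position being scanned, cell 18 the candidate neighbour and cell 19 the
    queue length. The queue starts with vertex 0 alone, which array 8 holds by default. *)
Definition search : cmd :=
  Seq (ISet 7 (IConst 0) (IConst 1))
  (Seq (ISet 19 (IConst 0) (IConst 1))
  (for_loop 12 (var 0)
    (for_loop 18 (var 0)
      (If (BAnd (BILe (IConst 1) (IGet 2 (bit (IGet 8 (var 12)) (var 18))))
                (BILe (IGet 7 (var 18)) (IConst 0)))
          visit Skip)))).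

(** Only the table with flag true is written: with flag false a singleton class admits only the
    empty set, which zero cells already represent. *)
Definition fill_cell : cmd :=
  If (BILe (IGet 3 (var 12)) (var 18))
    (Seq (RSet 2 (cell (var 12) (var 18)) (RGet 0 (var 12)))
         (ISet 11 (bit (cell (var 12) (var 18)) (var 12)) (IConst 1)))
    Skip.

Definition fill : cmd :=
  for_loop 12 (var 0) (for_loop 18 (IAdd (var 1) (IConst 1)) fill_cell).

(** Cells 13 and 14 hold the child [v] and its parent [u], cells 16 and 17 the budget [k] and the
    share [j] of [u]. The union is formed by adding characteristic vectors, which is sound as the
    two sets are disjoint. *)
Definition relax (d a : bool) : cmd :=
  let dst := cell (var 14) (var 16) in
  let src := cell (var 14) (var 17) in
  let src' := cell (var 13) (ISub (var 16) (var 17)) in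
  let sum := RAdd (RGet (weights a) src) (RGet (weights (~~ a)) src') in
  If (BRLe sum (RGet (weights d) dst)) Skip
    (Seq (RSet (weights d) dst sum)
         (for_loop 18 (var 0)
            (ISet (bits d) (bit dst (var 18))
               (IAdd (IGet (bits a) (bit src (var 18)))
                     (IGet (bits (~~ a)) (bit src' (var 18))))))).

(** The three pairs [d], [a] with [a ==> d]: a target avoiding [u] cannot come from a set that may
    contain [u]. *)
Definition relax_all : cmd :=
  Seq (relax false false) (Seq (relax true false) (relax true true)).

(* Descending budgets: the cells of smaller budget are still those from before
   the merge when they are read. *)
Definition merge_child : cmd :=
  for_loop 15 (var 1)
    (Seq (ISet 16 (IConst 0) (ISub (var 1) (var 15)))
         (for_loop 17 (var 16) relax_all)).

(** Positions run from the last down to 1, so that the root at position 0 remains. *)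
Definition contract_tree : cmd :=
  for_loop 12 (ISub (var 0) (IConst 1))
    (Seq (ISet 13 (IConst 0) (IGet 8 (ISub (ISub (var 0) (IConst 1)) (var 12))))
    (Seq (ISet 14 (IConst 0) (IGet 9 (ISub (ISub (var 0) (IConst 1)) (var 12))))
         merge_child)).

(** The answer is the entry of the root, vertex 0, with flag true and budget [B]; its cell has
    number [B]. *)
Definition write_output : cmd :=
  for_loop 18 (var 0) (ISet 4 (var 18) (IGet 11 (bit (var 1) (var 18)))).

Definition mwbis_program : cmd :=
  Seq address_tables (Seq search (Seq fill (Seq contract_tree write_output))).

(** * Correctness and running time *)

(** Uniqueness of Euclidean division: distinct table entries have distinct addresses. *)
Lemma digits_inj c q r q' r' :
  r < c -> r' < c -> q * c + r = q' * c + r' -> q = q' /\ r = r'.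
Proof.
move=> rc rc' E; have c0 : 0 < c by lia.
have := congr1 (divn^~ c) E; rewrite !divnMDl // !divn_small // !addn0 => qq.
by split=> //; subst q'; lia.
Qed.

(** * A single relaxation *)

Section Relaxation.
Variables (R : realType) (n : nat) (e : rel 'I_n).
Variables (w : 'I_n -> R) (b : 'I_n -> nat) (B : nat).
Implicit Types (s : state R) (u v x : 'I_n) (d a : bool).

Definition set_table := bool -> 'I_n -> nat -> {set 'I_n}.
Implicit Type tab : set_table.

(** What stays true once the address tables are computed: the input is intact and products can be
    looked up. *)
Definition static s : Prop :=
  [/\ imem s 0 0 = n, imem s 1 0 = B,
      forall u v, imem s 2 (u * n + v) = e u v,
      forall v, imem s 3 v = b v & forall v, rmem s 0 v = w v] /\
  (forall v, imem s 6 v = v * B.+1) /\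
  (forall c, c <= n * B.+1 -> imem s 5 c = c * n).

Lemma static_off (I J : seq nat) s s' :
  all (fun y : nat => y \notin I) [:: 0; 1; 2; 3; 5; 6] -> 0 \notin J ->
  same_off I J s s' -> static s -> static s'.
Proof.
move=> /and5P[i0 i1 i2 i3 /and3P[i5 i6 _]] j0 [iE rE] [[n_ B_ e_ b_ w_] [c_ m_]].
by do ![split] => *; rewrite ?iE ?rE //; auto.
Qed.

Definition represents s tab : Prop := forall d v k, k <= B ->
  rmem s (weights d) (v * B.+1 + k) = weight w (tab d v k) /\
  forall x, imem s (bits d) ((v * B.+1 + k) * n + x) = (x \in tab d v k).

Lemma represents_off (I J : seq nat) s s' tab :
  10 \notin I -> 11 \notin I -> 1 \notin J -> 2 \notin J ->
  same_off I J s s' -> represents s tab -> represents s' tab.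
Proof.
move=> i0 i1 j1 j2 [iE rE] H d v k kB; have [H1 H2] := H d v k kB.
by case: d H1 H2 => H1 H2; split=> [|x]; rewrite ?rE ?iE.
Qed.

Definition set_at tab d u k S : set_table :=
  fun d' u' k' => if [&& d' == d, u' == u & k' == k] then S else tab d' u' k'.

Lemma multiples_spec (a : nat) bound inc N c s :
  a != 12 -> imem s a 0 = 0 ->
  (forall s', same_off [:: 12; a] [::] s s'
    -> ieval s' bound = N /\ ieval s' inc = c) ->
  runs (multiples a bound inc) s (for_cost bound N (icost inc + 10))
    (fun s' => forall i, i <= N -> imem s' a i = i * c).
Proof.
move=> a12 a0 H.
apply: (@runs_for _ _ _ _ _ _ (fun i s' => forall j, j <= i
  -> imem s' a j = j * c)).
- by rewrite /= inE eq_sym.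
- by move=> s' /H[].
- by move=> j; rewrite leqn0 => /eqP->; rewrite /= /upd (negPf a12).
- move=> i s' iN i12 S' Pi.
  apply: (runs_weaken (Q := fun s1 => s1 = step (ISet a (IAdd (var 12)
    (IConst 1)) (IAdd (IGet a (var 12)) inc)) s')); first by apply: runs_flat.
    by rewrite /=; lia.
  move=> _ -> j ji; rewrite /= /upd (negPf a12) /= eqxx /= i12 addn1.
  have [-> | ji'] := eqVneq j i.+1; last by apply: Pi; lia.
  by rewrite Pi // (H _ S').2 mulSn addnC.
Qed.

Definition relax_post tab d a u v k j s' := exists S,
  [/\ represents s' (set_at tab d u k S),
      S = tab d u k \/ S = tab a u j :|: tab (~~ a) v (k - j),
      (weight w (tab d u k) <= weight w S)%R &
      (weight w (tab a u j) + weight w (tab (~~ a) v (k - j)%N) <= weight w S)%R].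

Lemma relax_spec s tab d a u v k j :
  static s -> represents s tab ->
  imem s 14 0 = u -> imem s 13 0 = v -> imem s 16 0 = k -> imem s 17 0 = j ->
  j < k <= B -> u != v -> [disjoint tab a u j & tab (~~ a) v (k - j)] ->
  runs (relax d a) s (62 + 50 * n) (relax_post tab d a u v k j).
Proof.
move=> St Rp u14 v13 k16 j17 /andP[jk kB] uv dis.
have [[n_ B_ e_ b_ w_] [c_ m_]] := St.
have un := ltn_ord u; have vn := ltn_ord v.
set cd := u * B.+1 + k; set ca := u * B.+1 + j; set cc := v * B.+1 + (k - j).
have cdE s' : same_off [:: 18; bits d] [:: weights d] s s' ->
  [/\ ieval s' (cell (var 14) (var 16)) = cd, ieval s' (cell (var 14)
    (var 17)) = ca,
      ieval s' (cell (var 13) (ISub (var 16) (var 17))) = cc &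
      [/\ imem s' 5 cd = cd * n, imem s' 5 ca = ca * n & imem s' 5 cc = cc * n]].
  case=> iE _.
  rewrite /= !iE ?u14 ?v13 ?k16 ?j17 ?c_; try by case: (d).
  split=> //; split; apply: m_; rewrite /cd /ca /cc; nia.
have [ed ea ec [m5d m5a m5c]] := cdE s (same_off_refl _ _ _).
have [wd bd] := Rp d u k kB; have [wa ba] := Rp a u j ltac:(lia).
have [wc bc] := Rp (~~ a) v (k - j) ltac:(lia).
set dst := cell (var 14) (var 16) in ed cdE.
set src := cell (var 14) (var 17) in ea cdE.
set src' := cell (var 13) (ISub (var 16) (var 17)) in ec cdE.
have sumE : reval s (RAdd (RGet (weights a) src) (RGet (weights (~~ a)) src'))
    = (weight w (tab a u j) + weight w (tab (~~ a) v (k - j)%N))%R.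
  by rewrite -wa -wc -/ca -/cc -ea -ec.
have bevE : beval s (BRLe (RAdd (RGet (weights a) src) (RGet (weights (~~ a)) src'))
      (RGet (weights d) dst))
    = (weight w (tab a u j) + weight w (tab (~~ a) v (k - j)%N) <= weight w
      (tab d u k))%R.
  by rewrite -sumE -wd -/cd -ed.
(* The test costs 26, the weight update 25 and the copying loop [50 * n + 10]. *)
have costE : 62 + 50 * n = (26 + (25 + (50 * n + 10))).+1 by lia.
rewrite costE; apply: runs_if; rewrite bevE => le.
  apply: (runs_weaken (t := 1) (Q := eq s)); [exact: runs_flat|lia|move=> _ <-].
  exists (tab d u k); split=> //; [|by left].
  by move=> d' v' k' kB'; rewrite /set_at; case: and3P =>
    [[/eqP-> /eqP-> /eqP->]|_]; apply: Rp.
apply: runs_seq; apply: (runs_weaken (t := 25)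
  (Q := eq (rset s (weights d) cd (weight w (tab a u j) + weight w (tab (~~ a) v
    (k - j)%N))%R))).
- by apply: runs_flat => //; rewrite /step sumE ed.
- by [].
move=> s1 s1E.
have S01 : same_off [::] [:: weights d] s s1.
  by rewrite -s1E; apply: rset_off.
have i01 y i : imem s1 y i = imem s y i by rewrite S01.1.
(* The first [m] bits of the target row are written, everything else in the array is old. *)
pose P (m : nat) s' := forall i, imem s' (bits d) i =
  if (cd * n <= i) && (i < cd * n + m) then
    imem s (bits a) (ca * n + (i - cd * n)) + imem s (bits (~~ a)) (cc * n +
      (i - cd * n))
  else imem s (bits d) i.
have S2W s' : same_off [:: 18; bits d] [::] s1 s' -> same_off [:: 18;
  bits d] [:: weights d] s s'.
  by move=> S'; apply: same_off_trans (same_offS _ _ S01) (same_offS _ _ S').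
have costE' : 50 * n + 10 = for_cost (var 0) n 37 by rewrite /for_cost /=; lia.
(* Both sources differ from the target cell, by [j < k] and by [u != v], so their rows are still
   unmodified when read. *)
have ne_ca : ca != cd by rewrite /ca /cd; lia.
have ne_cc : cc != cd.
  apply/negP => /eqP /digits_inj[||uv' _]; [lia|lia|].
  by move/negP: uv; apply; apply/eqP/val_inj.
have outside c (m x : nat) : c != cd -> m <= n -> x < n ->
    (cd * n <= c * n + x) && (c * n + x < cd * n + m) = false.
  move=> cne mn xn; apply/negP => /andP[h1 h2].
  have [|||cE _] := @digits_inj n c x cd (c * n + x - cd * n); [by []|lia|lia|].
  by rewrite cE eqxx in cne.
rewrite costE'; apply: runs_weaken (runs_frame (@runs_for _ 18
  (var 0) _ n 37 P s1 _ _ _ _)) _ _.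
- by case: (d).
- move=> s' S'; rewrite /= (S2W _ S').1 //; by case: (d).
- move=> i; rewrite addn0 /= /upd i01.
  have -> : (bits d == 18) = false by case: (d).
  by rewrite leqNgt andNb.
- move=> i s' iN i18 S' Pi.
  have [ed' ea' ec' [n5d n5a n5c]] := cdE _ (S2W _ S').
  have rd c f : c != cd -> imem s' (bits f) (c * n + i) = imem s (bits f)
    (c * n + i).
    move=> cne; have [fd|fd] := eqVneq f d.
      by rewrite fd Pi (outside _ _ _ cne (ltnW iN) iN).
    rewrite (S2W _ S').1 //; by case: (f) (d) fd => -[].
  apply: (runs_weaken (Q := eq (iset s' (bits d) (cd * n + i)
     (imem s (bits a) (ca * n + i) + imem s (bits (~~ a)) (cc * n + i))))).
  + apply: runs_flat => //.
    have bE c k0 m : ieval s' c = k0 -> imem s' 5 k0 = m -> ieval s' (bit c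
      (var 18)) = m + i.
      by move=> <- <-; rewrite -[in RHS]i18.
    rewrite /step (bE _ _ _ ed' n5d) -/ieval.
    rewrite -(rd _ a ne_ca) -(rd _ (~~ a) ne_cc).
    by rewrite -(bE _ _ _ ea' n5a) -(bE _ _ _ ec' n5c).
  + by [].
  move=> _ <- i'; rewrite /= /upd eqxx /=.
  have -> : (bits d == 18) = false by case: (d).
  have [->|ii] := eqVneq i' (cd * n + i); rewrite /=.
    by rewrite leq_addr addnS ltnS leqnn /= addKn.
  rewrite Pi addnS; congr (if _ && _ then _ else _).
  by rewrite ltnS [RHS]leq_eqVlt (negPf ii).
- by [].
move=> s' [Pn S'].
have {}S' : same_off [:: 18; bits d] [::] s1 s'.
  by apply: same_off_all S'; case: (d).
exists (tab a u j :|: tab (~~ a) v (k - j)); rewrite weightU //; split=> //;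
  last first.
- by rewrite ltW // ltNge.
- by right.
move=> d' v' k' kB'; rewrite /set_at S'.2 // -s1E /=.
case: and3P => [[/eqP-> /eqP-> /eqP->]|ne].
  split; first by rewrite /upd !eqxx weightU.
  move=> x; rewrite Pn -/cd leq_addr ltn_add2l ltn_ord /= addKn ba bc inE.
  (* Disjointness keeps the sum of two bits a bit. *)
  by case xa: (x \in tab a u j); rewrite ?(disjointFr dis xa).
have [H1 H2] := Rp d' v' k' kB'.
have neq : d' = d -> v' * B.+1 + k' != cd.
  move=> dd; apply/negP => /eqP /digits_inj[||vE kE]; [lia|lia|].
  by apply: ne; split; apply/eqP => //; apply: val_inj.
split.
  rewrite /upd; case: andP => // -[/eqP[dd] /eqP cE].
  have {}dd : d' = d by case: (d') (d) dd => -[].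
  by have := neq dd; rewrite cE eqxx.
move=> x; have [dd|dd] := eqVneq d' d.
  by rewrite dd Pn outside ?neq // -dd.
rewrite -H2 (S2W _ S').1 //; by case: (d') (d) dd => -[].
Qed.

End Relaxation.

(** * Merging a child into its parent *)

Section Merging.
Variables (R : realType) (n : nat) (e : rel 'I_n).
Variables (w : 'I_n -> R) (b : 'I_n -> nat) (B : nat).
Implicit Types (s : state R) (u v x : 'I_n) (d a : bool) (tab : set_table n).
Hypotheses (e_sym : symmetric e) (b_pos : forall v, 0 < b v).

Section MergeStep.
Variables (Du Dv : {set 'I_n}) (u v : 'I_n).
Hypotheses (uv : u != v) (Duv : [disjoint Du & Dv]).
Hypotheses (uD : u \in Du) (vD : v \in Dv) (euv : e u v).
Hypothesis cross : forall x y, x \in Du -> y \in Dv -> e x y -> x = u /\ y = v.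

Let feas := feasible e b (Du :|: Dv) u.

Lemma feasible_widen d k S : feasible e b Du u d k S -> feas d k S.
Proof. by case=> s1 i1 b1 u1; split=> //; apply: subset_trans s1 (subsetUl
  _ _). Qed.

(* [lev a] counts the splits j already tried with flag a for u (and ~~ a for v). *)
Definition relaxed tab d k (lev : bool -> nat) S : Prop :=
  [/\ feas d k S, (weight w (tab d u k) <= weight w S)%R &
      forall j a, j < lev a -> a ==> d ->
        (weight w (tab a u j) + weight w (tab (~~ a) v (k - j)%N) <= weight w S)%R].

Definition relaxing tab k (lev : bool -> bool -> nat) s : Prop := exists tab',
  [/\ represents w B s tab',
      forall d z k', ~~ ((z == u) && (k' == k)) -> tab' d z k' = tab d z k' &
      forall d, relaxed tab d k (lev d) (tab' d u k)].

Variables (tab : set_table n) (k : nat).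
Hypothesis kB : k <= B.
Hypothesis bestu : forall d j, j <= k -> best e w b Du u d j (tab d u j).
Hypothesis bestv : forall d j, j <= k -> best e w b Dv v d j (tab d v j).

Lemma relax_relaxing d a j (lev : bool -> bool -> nat) s :
  static e w b B s -> relaxing tab k lev s ->
  imem s 14 0 = u -> imem s 13 0 = v -> imem s 16 0 = k -> imem s 17 0 = j ->
  j < k -> a ==> d -> lev d a = j ->
  runs (relax d a) s (62 + 50 * n)
    (relaxing tab k (fun d' a' => if (d' == d) &&
      (a' == a) then j.+1 else lev d' a')).
Proof.
move=> St [tab' [Rp off rel]] u14 v13 k16 j17 jk ad lj.
have vu : (v == u) = false by rewrite eq_sym (negPf uv).
(* The sources are entries of budget [j < k] or of [v], untouched since the merge at budget [k]
   began. *)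
have tu c : tab' c u j = tab c u j.
  by apply: off; rewrite eqxx /= neq_ltn jk.
have tv c j' : tab' c v j' = tab c v j' by apply: off; rewrite vu.
have [Fa _] := @bestu a j (ltnW jk); have [Fc _] := @bestv (~~ a) (k - j)
  (leq_subr _ _).
have dis : [disjoint tab' a u j & tab' (~~ a) v (k - j)].
  rewrite tu tv; case: Fa => sa _ _ _; case: Fc => sc _ _ _.
  exact: disjointW sa sc Duv.
apply: runs_weaken (relax_spec d St Rp u14 v13 k16 j17 _ uv dis) _ _ => //.
  by rewrite jk.
move=> s' [S [Rp' SE le0 le1]]; exists (set_at tab' d u k S); split=> //.
  move=> d' z k' ne; rewrite -off // /set_at.
  by rewrite (negPf ne) andbF.
move=> d'; rewrite /set_at !eqxx !andbT; have [-> | ne] := eqVneq d' d; last first.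
  by have [f1 f2 f3] := rel d'; split.
have [f1 f2 f3] := rel d; split.
- case: SE => -> //; rewrite tu tv.
  apply: (feasibleU e_sym Duv uD cross ad _ (ltnW jk) Fa Fc).
  by rewrite andbN.
- exact: le_trans le0.
- move=> j' a'; rewrite /=; case: eqP => [->|_] lj' ad'; last first.
    exact: le_trans (f3 _ _ lj' ad') le0.
  move: lj'; rewrite ltnS leq_eqVlt => /orP[/eqP->|lt]; first by rewrite -tu -tv.
  by apply: le_trans le0; apply: f3 => //; rewrite lj.
Qed.

Lemma relax_loop_spec s :
  static e w b B s -> represents w B s tab ->
  imem s 14 0 = u -> imem s 13 0 = v -> imem s 16 0 = k ->
  runs (for_loop 17 (var 16) relax_all) s (for_cost (var 16) k (3 * (62 + 50 * n)))
    (fun s' => exists tab',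
      [/\ represents w B s' tab',
      forall d z k', ~~ ((z == u) && (k' == k)) -> tab' d z k' = tab d z k' &
      forall d, best e w b (Du :|: Dv) u d k (tab' d u k)]).
Proof.
move=> St Rp u14 v13 k16.
pose P (j : nat) := relaxing tab k (fun _ _ => j).
have Pw s1 s2 lev : same_off [:: 17] [::] s1 s2 ->
    relaxing tab k lev s1 -> relaxing tab k lev s2.
  move=> S12 [tab' [Rp' off rel]]; exists tab'; split=> //.
  exact: represents_off S12 Rp'.
apply: runs_weaken (@runs_for _ 17 (var 16) _ k (3 * (62 + 50 * n)) P s _ _ _ _)
  _ _.
- by [].
- by move=> s' [iE _]; rewrite /= iE.
- apply: Pw (iset_off _ _ _ _) _; exists tab; split=> // d; split=> //.
  by apply: feasible_widen; case: (@bestu d k (leqnn k)).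
- move=> j s' jk j17 S' Pj.
  have relax_all_off s1 s2 : same_off [:: 10; 11; 18] [:: 1; 2] s1 s2 ->
      [/\ static e w b B s1, imem s1 14 0 = u, imem s1 13 0 = v, imem s1 16 0 = k
        & imem s1 17 0 = j] ->
      [/\ static e w b B s2, imem s2 14 0 = u, imem s2 13 0 = v, imem s2 16 0 = k
        & imem s2 17 0 = j].
    move=> S12 [St1 h1 h2 h3 h4]; have [iE _] := S12.
    by split; rewrite ?iE //; apply: static_off S12 St1.
  have W d a s1 s2 : same_off (iwrites (relax d a)) (rwrites (relax d a)) s1 s2 ->
      same_off [:: 10; 11; 18] [:: 1; 2] s1 s2.
    by case: d; apply: same_off_all.
  have H0 : [/\ static e w b B s', imem s' 14 0 = u, imem s' 13 0 = v,
    imem s' 16 0 = k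
        & imem s' 17 0 = j].
    have [iE _] := S'; split=> //; rewrite ?iE //.
    by apply: static_off S' St.
  have -> : 3 * (62 + 50 * n) = (62 + 50 * n) + ((62 + 50 * n) +
    (62 + 50 * n)) by lia.
  apply: runs_seq; have [g0 g1 g2 g3 g4] := H0.
  apply: runs_weaken (runs_frame (@relax_relaxing false false j
    _ _ g0 Pj g1 g2 g3 g4 jk isT erefl)) (leqnn _) _.
  move=> s1 [P1 /W S1]; have {H0 g0 g1 g2 g3 g4} H0 := relax_all_off _ _ S1 H0.
  apply: runs_seq; have [g0 g1 g2 g3 g4] := H0.
  apply: runs_weaken (runs_frame (@relax_relaxing true false j
    _ _ g0 P1 g1 g2 g3 g4 jk isT erefl)) (leqnn _) _.
  move=> s2 [P2 /W S2]; have {H0 g0 g1 g2 g3 g4} H0 := relax_all_off _ _ S2 H0.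
  have [g0 g1 g2 g3 g4] := H0.
  apply: runs_weaken (@relax_relaxing true true j
    _ _ g0 P2 g1 g2 g3 g4 jk isT erefl) (leqnn _) _.
  move=> s3 P3; apply: Pw (iset_off _ _ _ _) _.
  case: P3 => tab' [Rp' off rel]; exists tab'; split=> // d.
  (* The level of the pair [d] false, [a] true was not raised, but [a ==> d] excludes it. *)
  have [f1 f2 f3] := rel d; split=> // j' a lt ad; apply: f3 => //.
  by case: d a ad {f1 f2 rel} => -[].
- by [].
- move=> s' [tab' [Rp' off rel]]; exists tab'; split=> // d;
    have [f1 f2 f3] := rel d.
  by apply: (best_merge b_pos Duv vD uD euv (t0 := fun a => tab a u) (t1 :=
    fun a => tab a v)) => // j a jk ad; apply: f3.
Qed.

End MergeStep.

Section MergeAll.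
Variables (Du Dv : {set 'I_n}) (u v : 'I_n).
Hypotheses (uv : u != v) (Duv : [disjoint Du & Dv]).
Hypotheses (uD : u \in Du) (vD : v \in Dv) (euv : e u v).
Hypothesis cross : forall x y, x \in Du -> y \in Dv -> e x y -> x = u /\ y = v.
Variable tab : set_table n.
Hypothesis bestu : forall d j, j <= B -> best e w b Du u d j (tab d u j).
Hypothesis bestv : forall d j, j <= B -> best e w b Dv v d j (tab d v j).

(** The loop over splits is charged for the full budget [B] in every round. *)
Definition merge_cost := for_cost (var 1) B (7 + for_cost (var 16) B (3 *
  (62 + 50 * n))).

(** After [i] rounds the entries of [u] of budget above [B - i] are final and those up to [B - i]
    are still the old ones, which is what the round for [B - i] reads. *)
Lemma merge_spec s :
  static e w b B s -> represents w B s tab ->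
  imem s 14 0 = u -> imem s 13 0 = v ->
  runs merge_child s merge_cost
    (fun s' => exists tab',
      [/\ represents w B s' tab',
      forall d z k, z != u -> tab' d z k = tab d z k &
      forall d k, k <= B -> best e w b (Du :|: Dv) u d k (tab' d u k)]).
Proof.
move=> St Rp u14 v13.
pose P (i : nat) s' := exists tab',
      [/\ represents w B s' tab',
      forall d z k, z != u -> tab' d z k = tab d z k,
      forall d k, k <= B - i -> tab' d u k = tab d u k &
      forall d k, B - i < k <= B -> best e w b (Du :|: Dv) u d k (tab' d u k)].
apply: runs_weaken (@runs_for _ 15 (var 1) _ B (7 + for_cost (var 16) B (3 *
  (62 + 50 * n))) P s _ _ _ _) _ _.
- by [].
- by move=> s' [iE _]; rewrite /= iE //; case: St => -[].
- exists tab; split=> //; last by move=> d k; lia.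
  exact: represents_off (iset_off _ _ _ _) Rp.
- move=> i s' iB i15 S' [tab1 [Rp1 off1 lo1 hi1]].
  have St' : static e w b B s' by apply: static_off S' St.
  have [iE _] := S'.
  apply: runs_seq; apply: (runs_weaken (t := 7) (Q := eq (iset s' 16 0 (B - i)))).
  + apply: runs_flat => //; rewrite /= i15.
    by case: St' => -[_ -> _ _ _] _.
  + by [].
  move=> s1 s1E.
  have S1 : same_off [:: 16] [::] s' s1.
    by rewrite -s1E; apply: iset_off.
  have kB : B - i <= B := leq_subr _ _.
  apply: (runs_weaken (relax_loop_spec uv Duv uD vD euv cross (tab := tab1) kB _
    _ _ _ _ _ _)).
  + by move=> d j jk; rewrite lo1 //; apply: bestu; lia.
  + by move=> d j jk; rewrite off1 1?eq_sym //; apply: bestv; lia.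
  + exact: static_off S1 St'.
  + exact: represents_off S1 Rp1.
  + by rewrite S1.1 // iE.
  + by rewrite S1.1 // iE.
  + by rewrite -s1E.
  + by rewrite /for_cost leq_add2r leq_add2r leq_mul2r kB orbT.
  move=> s2 [tab2 [Rp2 off2 best2]]; exists tab2; split.
  + exact: represents_off (iset_off _ _ _ _) Rp2.
  + by move=> d z k zu; rewrite off2 ?off1 // (negPf zu).
  + move=> d k kl; rewrite off2 ?lo1 //; first lia.
    by rewrite eqxx /=; lia.
  + move=> d k kk; have [->|ne] := eqVneq k (B - i); first exact: best2.
    rewrite off2 ?(negPf ne) ?andbF //; apply: hi1; lia.
- by [].
- move=> s' [tab' [Rp' off lo hi]]; exists tab'; split=> // d k kB.
  (* Budget 0 is never visited: it admits no split [j < 0], so the old entry is already optimal. *)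
  case: (posnP k) => [->|k0]; last by apply: hi; lia.
  apply: (best_merge b_pos Duv vD uD euv (t0 := fun a => tab a u) (t1 := fun a
    => tab a v)) => //.
  + by move=> a j; rewrite leqn0 => /eqP->; apply: bestu.
  + by move=> a j; rewrite leqn0 => /eqP->; apply: bestv.
  + by rewrite lo //; apply: feasible_widen; case: (@bestu d 0 (leq0n _)).
  + by rewrite lo.
Qed.

End MergeAll.
End Merging.

(** * Correctness of the search *)

Section Searching.
Variables (R : realType) (n : nat) (e : rel 'I_n).
Variables (w : 'I_n -> R) (b : 'I_n -> nat) (B : nat).
Implicit Types (s : state R) (x : 'I_n).
Hypothesis e_sym : symmetric e.
Hypothesis (e_conn : forall x y, connect e x y).
Variable x0 : 'I_n.
Hypothesis x00 : x0 = 0 :> nat.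

(* Cells of array 8 past the end of the queue are 0, that is x0: scanning them again
   is harmless because the vertex x0 is scanned first. *)
Definition scanned (i m : nat) s : Prop := exists q p : seq 'I_n,
  [/\ search_tree e x0 q p, size p = size q, nth x0 q 0 = x0 /\ 0 < size q
    & imem s 19 0 = size q] /\
  [/\ forall j, imem s 8 j = nth x0 q j, forall j, imem s 9 j = nth x0 p j,
      forall z : 'I_n, imem s 7 z = (z \in q),
      forall j y, j < i -> j < size q -> e (nth x0 q j) y -> y \in q &
      forall y : 'I_n, y < m -> e (nth x0 q i) y -> y \in q].

Lemma scanned_off (I J : seq nat) i m s s' :
  all (fun y : nat => y \notin I) [:: 7; 8; 9; 19] -> same_off I J s s' ->
  scanned i m s -> scanned i m s'.
Proof.
move=> /and5P[i7 i8 i9 i19 _] [iE _] [q [p [[h1 h2 h3 h4] [h5 h6 h7 h8 h9]]]].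
by exists q, p; split; split=> // *; rewrite iE.
Qed.

Lemma visit_scanned i x s (q p : seq 'I_n) :
  imem s 12 0 = i -> imem s 18 0 = x -> x \notin q -> e (nth x0 q i) x ->
  [/\ search_tree e x0 q p, size p = size q, nth x0 q 0 = x0 /\ 0 < size q
    & imem s 19 0 = size q] ->
  [/\ forall j, imem s 8 j = nth x0 q j, forall j, imem s 9 j = nth x0 p j,
      forall z : 'I_n, imem s 7 z = (z \in q),
      forall j y, j < i -> j < size q -> e (nth x0 q j) y -> y \in q &
      forall y : 'I_n, y < x -> e (nth x0 q i) y -> y \in q] ->
  scanned i x.+1 (step visit s).
Proof.
move=> i12 x18 xq ex [[uq par] sz [q0 szq] tail] [m8 m9 m7 cl clx].
(* Past the end of the queue the scanned vertex reads as [x0], whose neighbours were all found at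
   position 0, so no new vertex can appear there. *)
have iq : i < size q.
  rewrite ltnNge; apply/negP => qi; move: ex; rewrite nth_default // => ex.
  by move/negP: xq; apply; apply: (cl 0) => //; [lia|rewrite q0].
exists (rcons q x), (rcons p (nth x0 q i)).
have nq j : nth x0 (rcons q x) j = if j == size q then x else nth x0 q j.
  rewrite nth_rcons; case: ltngtP => // lt; by rewrite nth_default // ltnW.
have np j : nth x0 (rcons p
  (nth x0 q i)) j = if j == size q then nth x0 q i else nth x0 p j.
  rewrite nth_rcons sz; case: ltngtP => // lt; by rewrite nth_default // sz ltnW.
split.
  split; rewrite ?size_rcons ?sz //.
  - split; first by rewrite rcons_uniq xq.
    move=> j; rewrite size_rcons ltnS => /andP[j0 jq].
    have tk : take j (rcons q x) = take j q by rewrite -cats1 takel_cat.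
    rewrite nq np tk; case: eqP => [->|ne]; last first.
      by apply: par; rewrite j0 ltn_neqAle jq andbT; apply/eqP.
    by rewrite take_size mem_nth // e_sym.
  - by rewrite nq; case: eqP => // E; rewrite -E in szq.
  - by rewrite /= /upd /= tail addn1.
split.
- move=> j; rewrite /= /upd /= tail x18 nq.
  by case: eqP => // _; rewrite m8.
- move=> j; rewrite /= /upd /= tail i12 np.
  have -> : (i == size q) = false by lia.
  by case: eqP => // _; rewrite ?m8 ?m9.
- move=> z; rewrite /= /upd /= x18 mem_rcons inE -[_ == x]/(val z == val x).
  by case: eqP => //= _; rewrite m7.
- move=> j y ji _; rewrite nq mem_rcons inE.
  have -> : (j == size q) = false by lia.
  by move=> ey; rewrite (cl j) ?orbT //; lia.
- move=> y; rewrite ltnS nq mem_rcons inE.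
  have -> : (i == size q) = false by lia.
  rewrite leq_eqVlt => /orP[/eqP yx|yx] ey; last by rewrite clx ?orbT.
  by apply/orP; left; apply/eqP/val_inj.
Qed.

Definition search_cost := 10 + for_cost (var 0) n (for_cost (var 0) n 60).

(** At the end the discovered set contains [x0] and is closed under adjacency; connectedness makes
    it everything. *)
Lemma search_spec s :
  static e w b B s -> (forall i, imem s 7 i = 0) ->
  (forall i, imem s 8 i = 0) -> (forall i, imem s 9 i = 0) ->
  runs search s search_cost (fun s' => exists q p : seq 'I_n,
    [/\ search_tree e x0 q p, nth x0 q 0 = x0 /\ size q = n, forall x, x \in q,
        forall j, imem s' 8 j = nth x0 q j & forall j, imem s' 9 j = nth x0 p j]).
Proof.
move=> St z7 z8 z9.
set s1 := step (Seq (ISet 7 (IConst 0) (IConst 1)) (ISet 19 (IConst 0)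
  (IConst 1))) s.
have S1 : same_off [:: 7; 19] [::] s s1.
  apply: (@same_off_trans _ _ _ _ (iset s 7 0 1)).
    by apply: same_off_all (iset_off _ _ _ _).
  by apply: same_off_all (iset_off _ _ _ _).
have I0 : scanned 0 0 s1.
  exists [:: x0], [:: x0]; split; split=> //.
  - by split=> // -[|j].
  - by move=> [|[|j]]; rewrite /= /upd /= z8.
  - by move=> [|[|j]]; rewrite /= /upd /= z9.
  - by move=> z;
      rewrite /= /upd /= inE -[z == x0]/(nat_of_ord z == nat_of_ord x0) x00 z7;
        case: eqP.
have -> : search_cost = 5 + (5 + for_cost (var 0) n (for_cost (var 0) n 60)).
  by rewrite /search_cost; lia.
apply: runs_seq; apply: (runs_weaken (t := 3) (Q := eq (iset s 7 0 1))) => //.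
  exact: runs_flat.
move=> _ <-.
apply: runs_seq; apply: (runs_weaken (t := 3) (Q := eq s1)) => //.
  exact: runs_flat.
move=> _ <-.
have St1 : static e w b B s1 by apply: static_off S1 St.
have [[n1 _ _ _ _] _] := St1.
apply: runs_weaken (@runs_for _ 12 (var 0) _ n (for_cost (var 0) n 60) (fun i
  => scanned i 0) s1 _ _ _ _) _ _ => //.
- by move=> s' [iE _]; rewrite /= iE.
- move=> i s' iN i12 S' Pi.
  have St' : static e w b B s' by apply: static_off S' St1.
  have n' : imem s' 0 0 = n by case: St' => -[].
  apply: runs_weaken (@runs_for _ 18 (var 0) _ n 60 (fun m => scanned i m) s' _
    _ _ _) _ _ => //.
  + by move=> s2 [iE _]; rewrite /= iE.
  + move=> m s2 mn m18 S2 [q [p [Pa Pb]]].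
    have St2 : static e w b B s2 by apply: static_off S2 St'.
    have [[_ _ e2 _ _] [_ m5]] := St2.
    have j12 : imem s2 12 0 = i by rewrite S2.1.
    have [m8 m9 m7 cl clx] := Pb.
    pose x := Ordinal mn.
    have adjE : imem s2 2 (imem s2 5 (imem s2 8
      (imem s2 12 0)) + imem s2 18 0) = e (nth x0 q i) x.
      rewrite j12 m8 m18 m5; first exact: (e2 (nth x0 q i) x).
      by have := ltn_ord (nth x0 q i); nia.
    have seenE : imem s2 7 (imem s2 18 0) = (x \in q) by rewrite m18; exact: (m7 x).
    suff : scanned i m.+1 (step (If (BAnd (BILe (IConst 1) (IGet 2 (bit (IGet 8
      (var 12)) (var 18))))
                (BILe (IGet 7 (var 18)) (IConst 0))) visit Skip) s2).
      move=> H; apply: (runs_weaken (runs_flat _ _)); [by []|exact: H|by []|].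
      by move=> s3; exact: (scanned_off _ (iset_off _ _ _ _)).
    rewrite [step _ _]/step -/step [beval _ _]/=.
    rewrite adjE seenE lt0b leqn0 eqb0.
    case: andP => [[ex xq]|nex]; first exact:
      (@visit_scanned i x s2 q p j12 m18 xq ex Pa Pb).
    exists q, p; split=> //; split=> // y; rewrite ltnS leq_eqVlt
      => /orP[/eqP yx|yx] ey.
      have yE : y = x by apply: val_inj.
      by apply/negPn/negP => yq; apply: nex; rewrite -yE.
    exact: clx.
  + move=> s2 [q [p [[h1 h2 h3 h4] [h5 h6 h7 h8 h9]]]].
    apply: (scanned_off _ (iset_off _ _ _ _)) => //; exists q, p; split=> //;
      split=> //.
    move=> j y; rewrite ltnS leq_eqVlt => /orP[/eqP->|ji] jq ey; last exact: h8 ey.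
    by apply: h9.
move=> s' [q [p [[h1 h2 h3 h4] [h5 h6 h7 h8 h9]]]].
have [uq _] := h1; have [q0 szq] := h3.
(* The queue has no repetition, so the [n] rounds have scanned all of it. *)
have szn : size q <= n.
  by rewrite -(card_uniqP uq) -[X in _ <= X]card_ord max_card.
have clos y z : y \in q -> e y z -> z \in q.
  move=> yq ey; have iq : index y q < size q by rewrite index_mem.
  by apply: (h8 (index y q)) => //; [lia|rewrite nth_index].
have all_q x : x \in q.
  have /connectP[c pc ->] := e_conn x0 x.
  have : x0 \in q by rewrite -q0 mem_nth.
  elim: c (x0) pc => //= y c IH z /andP[ez pc] zq.
  by apply: IH pc _; apply: clos ez.
exists q, p; split=> //; split=> //; rewrite -(card_uniqP uq) -[RHS]card_ord.
by apply: eq_card => x; rewrite all_q.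
Qed.

End Searching.

(** * Initial tables, contraction and assembly of the phases *)

Section Correctness.
Variables (R : realType) (n : nat) (e : rel 'I_n).
Variables (w : 'I_n -> R) (b : 'I_n -> nat) (B : nat).
Implicit Types (s : state R) (u v x : 'I_n) (d a : bool) (tab : set_table n).

Section Fill.

(** Cells are counted in one linear order, so that the two nested loops share this invariant. *)
Definition filled (c : nat) s : Prop := forall v k, k <= B ->
  rmem s 2 (v * B.+1 + k) = (if (v * B.+1 + k < c)%N &&
    (b v <= k)%N then w v else 0)%R /\
  forall x, imem s 11 ((v * B.+1 + k) * n + x) = [&& v * B.+1 + k < c,
    b v <= k & x == v].

Lemma fill_cell_filled i k s : static e w b B s ->
  imem s 12 0 = i -> imem s 18 0 = k -> i < n -> k <= B ->
  filled (i * B.+1 + k) s -> filled (i * B.+1 + k).+1 (step fill_cell s).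
Proof.
move=> [[_ _ _ b3 w0] [c6 m5]] i12 k18 iN kB F.
pose u := Ordinal iN.
have stepE : step fill_cell s =
    if b u <= k then iset (rset s 2 (i * B.+1 + k) (w u)) 11
      ((i * B.+1 + k) * n + i) 1 else s.
  rewrite /fill_cell /= i12 k18 (b3 u) (c6 u) (w0 u) /=.
  by rewrite m5 //; nia.
move=> v k' kB'; have [F1 F2] := F v k' kB'; rewrite {}stepE ltnS.
have [ck|ck] := eqVneq (v * B.+1 + k') (i * B.+1 + k).
  have [vE kE] : v = i :> nat /\ k' = k by apply: digits_inj ck; lia.
  have {}vE : v = u by apply: val_inj.
  subst k' v; rewrite leqnn /= in F1 F2 *.
  case: (leqP (b u) k) => bk; rewrite ?ltnn /= in F1 F2 *.
    split; first by rewrite /upd !eqxx.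
    by move=> x; rewrite /upd /= eqn_add2l F2 -[x == u]/(nat_of_ord x == i);
      case: eqP.
  by split.
have -> : (v * B.+1 + k' <= i * B.+1 + k) = (v * B.+1 + k' < i * B.+1 + k).
  by rewrite leq_eqVlt (negPf ck).
case: ifP => // _; split.
  by rewrite /= /upd (negPf ck).
move=> x; rewrite /= /upd /=; case: eqP => // /digits_inj[||cE _].
- exact: ltn_ord.
- exact: iN.
- by rewrite cE eqxx in ck.
Qed.

Definition initial_table : set_table n :=
  fun d v k => if d && (b v <= k) then [set v] else set0.

Definition fill_cost := for_cost (var 0) n (for_cost (IAdd (var 1)
  (IConst 1)) B.+1 29).

Lemma fill_spec s : static e w b B s ->
  (forall i, imem s 10 i = 0) -> (forall i, imem s 11 i = 0) ->
  (forall i, rmem s 1 i = 0%R) -> (forall i, rmem s 2 i = 0%R) ->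
  runs fill s fill_cost (fun s' => represents w B s' initial_table).
Proof.
move=> St z10 z11 r1 r2.
have [[n1 B1 _ _ _] _] := St.
have F0 : filled 0 s by move=> v k kB; split=> [|x]; rewrite ?r2 ?z11 ltn0.
apply: runs_weaken (runs_frame (@runs_for _ 12 (var 0) _ n (for_cost (IAdd
  (var 1) (IConst 1)) B.+1 29) (fun i => filled (i * B.+1)) s _ _ _ _)) _ _ => //.
- by move=> s' [iE _]; rewrite /= iE.
- move=> i s' iN i12 S' Pi.
  have St' : static e w b B s' by apply: static_off S' St.
  have B' : imem s' 1 0 = B by case: St' => -[].
  apply: runs_weaken (@runs_for _ 18 (IAdd (var 1) (IConst 1)) _ B.+1 29 (fun m
    => filled (i * B.+1 + m)) s' _ _ _ _) _ _ => //.
  + by move=> s2 [iE _]; rewrite /= iE // B' addn1.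
  + by rewrite addn0.
  + move=> m s2 mB m18 S2 Pm.
    have St2 : static e w b B s2 by apply: static_off S2 St'.
    have j12 : imem s2 12 0 = i by rewrite S2.1.
    have := fill_cell_filled St2 j12 m18 iN mB Pm; rewrite -addnS => H.
    by apply: (runs_weaken (runs_flat _ _)); [by []|exact: H| |].
  + by move=> s2; rewrite mulSn addnC.
- move=> s' [F S'] d v k kB; have [F1 F2] := F v k kB.
  have lt : v * B.+1 + k < n * B.+1 by have := ltn_ord v; nia.
  rewrite lt /= in F1 F2; rewrite /initial_table.
  case: d => /=; last first.
    split=> [|x]; first by rewrite S'.2 // r1 weight0.
    by rewrite S'.1 // z10 inE.
  split=> [|x]; first by rewrite F1; case: ifP; rewrite ?weight0 ?weight1.
  by rewrite F2; case: ifP; rewrite inE.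
Qed.

End Fill.

Hypotheses (e_sym : symmetric e) (e_irr : irreflexive e) (e_acyc : acyclic e).
Hypotheses (e_conn : forall x y, connect e x y).
Hypotheses (w_pos : forall v, (0 < w v)%R) (b_pos : forall v, 0 < b v).
Variable x0 : 'I_n.
Hypothesis x00 : x0 = 0 :> nat.

Definition contract_cost :=
  for_cost (ISub (var 0) (IConst 1)) n.-1 (20 + merge_cost n B).

(** After [i] rounds the first [n - i] vertices remain, with tables optimal for their classes. After
    [n.-1] rounds only the root is left, and its class is the whole tree. *)
Lemma contract_tree_spec s (q p : seq 'I_n) :
  static e w b B s -> represents w B s (initial_table) ->
  search_tree e x0 q p -> nth x0 q 0 = x0 -> size q = n -> (forall x, x \in q) ->
  (forall j, imem s 8 j = nth x0 q j) -> (forall j, imem s 9 j = nth x0 p j) ->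
  runs contract_tree s contract_cost (fun s' => exists tab,
    represents w B s' tab /\ best e w b setT x0 true B (tab true x0 B)).
Proof.
move=> St Rp Sq q0 szq all_q m8 m9.
have [[n1 _ _ _ _] _] := St.
have n0 : 0 < n by case: (n) x0 => // -[].
pose P i s' := exists tab D, [/\ represents w B s' tab, contracted e q (n - i) D &
  {in take (n - i) q, forall z d k, k <= B -> best e w b (D z) z d k (tab d z k)}].
apply: runs_weaken (@runs_for _ 12 (ISub (var 0) (IConst 1)) _ n.-1
  (20 + merge_cost n B) P s _ _ _ _) _ _ => //.
- by move=> s' [iE _]; rewrite /= iE // n1 subn1.
- exists initial_table, (fun z => [set z]); rewrite subn0; split.
  + exact: (represents_off _ _ _ _ (iset_off _ _ _ _) Rp).
  + by have := contracted_full e all_q; rewrite szq.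
  + by move=> z _ d k _; apply: best_singleton.
- move=> i s' iN i12 S' [tab [D [Rp' ctr bst]]].
  have St' : static e w b B s' by apply: static_off S' St.
  have [[n' _ _ _ _] _] := St'.
  set m := n - i.+1.
  have mE : n - i = m.+1 by rewrite /m; lia.
  have mq : 0 < m < size q by rewrite szq /m; lia.
  rewrite mE in ctr bst.
  have {}m8 j : imem s' 8 j = nth x0 q j by rewrite S'.1.
  have {}m9 j : imem s' 9 j = nth x0 p j by rewrite S'.1.
  set v := nth x0 q m; set u := nth x0 p m.
  have -> : 20 + merge_cost n B = 10 + (10 + merge_cost n B) by lia.
  have idxE : n - 1 - i = m by rewrite /m; lia.
  apply: runs_seq; apply: (runs_weaken (t := 10) (Q := eq (iset s' 13 0 v))) => //.
    by apply: runs_flat => //; rewrite /= n' i12 idxE m8.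
  move=> _ <-.
  apply: runs_seq; apply: (runs_weaken (t := 10) (Q := eq (iset
    (iset s' 13 0 v) 14 0 u))) => //.
    by apply: runs_flat => //; rewrite /= /upd /= n' i12 idxE m9.
  move=> s1 s1E.
  have S1 : same_off [:: 13; 14] [::] s' s1.
    rewrite -s1E; apply: (@same_off_trans _ _ _ _ (iset s' 13 0 v)).
      by apply: same_off_all (iset_off _ _ _ _).
    by apply: same_off_all (iset_off _ _ _ _).
  have ctr' := contracted_step e_sym e_acyc Sq mq ctr.
  have [uq /(_ m mq)/andP[pin ep]] := Sq; have [m0 mq'] := andP mq.
  have [_ self dis cross] := ctr.
  have T : take m.+1 q = rcons (take m q) v by rewrite (take_nth x0).
  have vT : v \in take m.+1 q by rewrite T mem_rcons inE eqxx.
  have sT z : z \in take m q -> z \in take m.+1 q.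
    by move=> zq; rewrite T mem_rcons inE zq orbT.
  have zv z : z \in take m q -> z != v.
    have := take_uniq m.+1 uq; rewrite T rcons_uniq => /andP[vq _] zq.
    by apply/eqP => zv; rewrite -zv zq in vq.
  have uT := sT _ pin; have uv := zv _ pin.
  apply: runs_weaken (merge_spec e_sym b_pos uv (dis _ _ uT vT uv) (self _ uT)
    (self _ vT)
    _ (cross _ _ uT vT uv) (bst _ uT) (bst _ vT) _ _ _ _) _ _.
  + by rewrite e_sym.
  + exact: static_off S1 St'.
  + exact: represents_off S1 Rp'.
  + by rewrite -s1E.
  + by rewrite -s1E.
  + by [].
  move=> s2 [tab' [Rp2 off best2]]; exists tab', (contract D u v); rewrite -/m;
    split=> //.
  + exact: (represents_off _ _ _ _ (iset_off _ _ _ _) Rp2).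
  + move=> z zq d k kB; rewrite /contract; case: eqP => [->|/eqP zu];
      first exact: best2.
    by rewrite off //; apply: bst => //; apply: sT.
- move=> s' [tab [D [Rp' [cov self dis cross] bst]]]; exists tab; split=> //.
  have T : take (n - n.-1) q = [:: x0].
    have -> : n - n.-1 = 1 by lia.
    by case: (q) q0 szq => [_ E|y q' /= -> _]; [rewrite -E in n0|rewrite take0].
  rewrite T in cov bst.
  have -> : setT = D x0.
    apply/esym/setP => x; rewrite inE; have [z] := cov x.
    by rewrite inE => /eqP->.
  by apply: bst; rewrite ?inE.
Qed.

Lemma write_output_spec s tab : static e w b B s -> represents w B s tab ->
  runs write_output s (for_cost (var 0) n 20)
    (fun s' => output n s' = tab true x0 B).
Proof.
move=> St Rp; have [[n1 B1 _ _ _] [_ m5]] := St.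
apply: runs_weaken (@runs_for _ 18 (var 0) _ n 20 (fun i s' => forall x, x < i
  -> imem s' 4 x = (x \in tab true x0 B)) s _ _ _ _) _ _ => //.
- by move=> s' [iE _]; rewrite /= iE.
- move=> i s' iN i18 S' Pi.
  have outE : imem s' 11 (imem s' 5 (imem s' 1 0) + imem s' 18 0) =
    (Ordinal iN \in tab true x0 B).
    rewrite i18 !S'.1 // B1 m5; last by nia.
    by have [_ /(_ (Ordinal iN))] := Rp true x0 B (leqnn B); rewrite x00.
  apply: (runs_weaken (Q := eq (iset s' 4 i (Ordinal iN \in tab true x0 B)))).
  + by apply: runs_flat => //; rewrite /= outE i18.
  + by [].
  move=> _ <- x; rewrite ltnS leq_eqVlt /= /upd /=.
  have [xi _|xi /= lt] := eqVneq (nat_of_ord x) i; last exact: Pi.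
  by have -> : x = Ordinal iN by apply: val_inj.
- move=> s' H; apply/setP => x; rewrite inE H //.
  by case: (x \in _).
Qed.

Lemma adjacencyE u v : adjacency e (u * n + v) = e u v.
Proof.
have n0 : 0 < n by case: (n) u => // -[].
by rewrite /adjacency divnMDl // modnMDl divn_small ?modn_small // addn0 !valK.
Qed.

Definition address_cost := for_cost (var 0) n 14 + for_cost (IGet 6 (var 0))
  (n * B.+1) 12.

Lemma address_tables_spec :
  runs address_tables (input e w b B) address_cost (static e w b B).
Proof.
apply: runs_seq.
apply: runs_weaken (runs_frame (@multiples_spec R 6 (var 0) (IAdd (var 1)
  (IConst 1)) n B.+1 _ _ _ _)) (leqnn _) _ => //.
  by move=> s' [iE _]; rewrite /= !iE // addn1.
move=> s1 [m6 S1]; have n1 : imem s1 0 0 = n by rewrite S1.1.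
apply: runs_weaken (runs_frame (@multiples_spec R 5 (IGet 6 (var 0)) (var 0)
  (n * B.+1) n _ _ _ _)) (leqnn _) _ => //.
  by rewrite S1.1.
  by move=> s' [iE _]; rewrite /= !iE // n1 m6.
move=> s2 [m5 S2].
split; last by split=> // v; rewrite S2.1 // m6 // ltnW.
split=> [||u v|v|v].
- by rewrite S2.1 // S1.1.
- by rewrite S2.1 // S1.1.
- by rewrite S2.1 // S1.1 //= adjacencyE.
- by rewrite S2.1 // S1.1 //= valK.
- by rewrite S2.2 // S1.2 //= valK.
Qed.

Lemma mwbis_program_spec :
  runs mwbis_program (input e w b B)
    (address_cost + (search_cost n + (fill_cost + (contract_cost + for_cost
      (var 0) n 20))))
    (fun s => is_MWBIS e w b B (output n s)).
Proof.
have z0 s1 (r : nat) : same_off (iwrites address_tables)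
  (rwrites address_tables) (input e w b B) s1 ->
  r \notin iwrites address_tables -> 4 < r -> forall i, imem s1 r i = 0.
  by move=> S1 na r4 i; rewrite S1.1 //; case: r r4 {na} => // -[|[|[|[|]]]].
apply: runs_seq.
apply: runs_weaken (runs_frame address_tables_spec) (leqnn _) _ => s1 [St1 S1].
have Z1 := z0 s1 _ S1.
apply: runs_seq; apply: runs_weaken (runs_frame
  (search_spec e_sym e_conn x00 St1 _ _ _)) (leqnn _) _; try exact: Z1.
move=> s2 [[q [p [Sq [q0 szq] all_q m8 m9]]] S2].
have St2 : static e w b B s2 by apply: static_off S2 St1.
apply: runs_seq; apply: runs_weaken (runs_frame (fill_spec St2 _ _ _ _))
  (leqnn _) _.
- by move=> i; rewrite S2.1 // Z1.
- by move=> i; rewrite S2.1 // Z1.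
- by move=> i; rewrite S2.2 // S1.2.
- by move=> i; rewrite S2.2 // S1.2.
move=> s3 [Rp3 S3].
have St3 : static e w b B s3 by apply: static_off S3 St2.
apply: runs_seq; apply: runs_weaken (runs_frame
  (contract_tree_spec St3 Rp3 Sq q0 szq all_q _ _)) (leqnn _) _.
- by move=> j; rewrite S3.1.
- by move=> j; rewrite S3.1.
move=> s4 [[tab [Rp4 [[_ ind bud _] opt]]] S4].
have St4 : static e w b B s4 by apply: static_off S4 St3.
apply: runs_weaken (write_output_spec St4 Rp4) (leqnn _) _ => s5 ->.
(* With flag true and class [setT], feasibility is exactly being a [B]-budgeted independent set. *)
split; first by split.
by move=> S' [indS' budS']; apply: opt; split.
Qed.

End Correctness.

(** * Total running time *)

(** The dominant phase is the contraction: fewer than [n] merges, each with at most [B * B] splits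
    of cost linear in [n]. As [n] and [B] are at least 1, every monomial that occurs is below
    [n ^ 2 * B ^ 3]; 2000 is a generous constant. *)
Lemma mwbis_time n B : 0 < n -> 0 < B ->
  address_cost n B + (search_cost n + (fill_cost n B +
    (contract_cost n B + for_cost (var 0) n 20)))
  <= 2000 * (n ^ 2 * B ^ 3).
Proof.
move=> n0 B0; set M := n ^ 2 * B ^ 3.
have h4 : n * n * B * B <= M by rewrite /M !expnS !expn0; nia.
have h3 : n * B * B <= M by apply: leq_trans h4; nia.
have h2 : n * B <= M by apply: leq_trans h3; nia.
have h1 : n <= M by apply: leq_trans h2; nia.
have h0 : n * n <= M by apply: leq_trans h4; nia.
have hc : contract_cost n B <= for_cost (ISub (var 0) (IConst 1)) n
  (20 + merge_cost n B).
  by rewrite /contract_cost /for_cost !leq_add2r leq_mul2r leq_pred orbT.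
move: M h4 h3 h2 h1 h0 hc => M; move: (contract_cost _ _) => c.
rewrite /address_cost /search_cost /fill_cost /merge_cost /for_cost /=; nia.
Qed.

Unset Implicit Arguments.

Theorem theorem2 (R : realType) :
  exists (p : cmd) (c : nat),
  forall (n : nat) (e : rel 'I_n) (w : 'I_n -> R) (b : 'I_n -> nat) (B : nat),
    is_tree e -> (forall v, (0 < w v)%R) -> (forall v, 0 < b v) -> 0 < B ->
    exists (t : nat) (s : state R),
      [/\ exec p (input e w b B) t s,
          t <= c * (n ^ 2 * B ^ 3) &
          is_MWBIS e w b B (output n s)].
Proof.
exists mwbis_program, 2000 => n e w b B
  [n0 e_sym e_irr e_conn e_acyc] w_pos b_pos B0.
rewrite card_ord in n0.
have [t [s [E le H]]]
  := @mwbis_program_spec R n e w b B e_sym e_irr e_acyc e_conn w_pos b_pos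
    (Ordinal n0) erefl.
exists t, s; split=> //; apply: leq_trans le _; exact: mwbis_time.
Qed.
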